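(* If the kernel $\mathcal K$ has rank $n-1$, i.e. one less than the number $n$ of vertices, then $\mathcal K$ is a right group.
   Context: The setting: a directed graph on the vertex set $\{1,\ldots,n\}$, $n\ge2$, in which each vertex has out-degree $d$, with adjacency matrix $\mathcal A$ such that $A=d^{-1}\mathcal A$ is irreducible and aperiodic; $\mathcal A=C_1+\cdots+C_d$, where each $C_i$ is a binary stochastic matrix (a $0$-$1$ matrix with exactly one $1$ in each row). $\mathcal S$ is the finite semigroup generated by the $C_i$ under matrix multiplication, and $\mathcal K$ is its kernel (minimal ideal, consisting of the elements of minimal rank); the rank of the kernel is the common rank of its elements. The partition of $k\in\mathcal K$ is the partition of the vertices into the nonempty blocks $\{i:k_{ij}=1\}$. $\mathcal K$ is a right group if, in its Rees product decomposition $\mathcal X\times\mathcal G\times\mathcal Y$ ($\mathcal X$ identified with the set of partitions, $\mathcal Y$ with the set of ranges), $\mathcal X$ is a single point; equivalently, all elements of $\mathcal K$ have the same partition. *)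

(* Defs.v *)
From HB Require Import structures.
From mathcomp Require Import all_boot all_order all_algebra all_fingroup.

Set Implicit Arguments.
Unset Strict Implicit.
Unset Printing Implicit Defensive.

Import Order.TTheory GRing.Theory Num.Theory.
Local Open Scope ring_scope.

Definition binary_stochastic n (C : 'M[rat]_n) : Prop :=
  (forall i j, C i j = 0 \/ C i j = 1) /\ (forall i, exists! j, C i j = 1).

Definition irreducible_mx n (A : 'M[rat]_n) : Prop :=
  forall i j, exists2 m : nat, (0 < m)%N & 0 < (A ^+ m) i j.

(* The return times to each vertex have greatest common divisor 1. *)
Definition aperiodic_mx n (A : 'M[rat]_n) : Prop :=
  forall (i : 'I_n) (g : nat),
    (forall m : nat, (0 < m)%N -> 0 < (A ^+ m) i i -> (g %| m)%N) -> g = 1%N.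

(* A directed graph is given by its matrix of edge multiplicities, so loops
   and parallel edges are allowed. *)
Definition out_regular n (d : nat) (Adj : 'M[nat]_n) : Prop :=
  forall i, (\sum_(j < n) Adj i j)%N = d.

Definition adjacency_mx n (Adj : 'M[nat]_n) : 'M[rat]_n :=
  map_mx (fun a : nat => a%:R) Adj.

(* Nonempty products only: the identity is not adjoined. *)
Inductive semigroup_gen n d (C : 'I_d -> 'M[rat]_n) : 'M[rat]_n -> Prop :=
| SemigroupGen i : semigroup_gen C (C i)
| SemigroupMul x y :
    semigroup_gen C x -> semigroup_gen C y -> semigroup_gen C (x *m y).

Definition ideal n (S J : 'M[rat]_n -> Prop) : Prop :=
  [/\ exists x, J x,
      forall x, J x -> S x,
      forall s x, S s -> J x -> J (s *m x)
    & forall s x, S s -> J x -> J (x *m s)].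

Definition is_kernel n (S K : 'M[rat]_n -> Prop) : Prop :=
  ideal S K /\
  (forall J, ideal S J -> (forall x, J x -> K x) -> forall x, K x -> J x).

Definition kernel_rank n (K : 'M[rat]_n -> Prop) (r : nat) : Prop :=
  forall k, K k -> \rank k = r.

Definition block n (k : 'M[rat]_n) (j : 'I_n) : {set 'I_n} :=
  [set i | k i j == 1].

Definition partition_of n (k : 'M[rat]_n) : {set {set 'I_n}} :=
  [set block k j | j : 'I_n & block k j != set0].

Definition range_of n (k : 'M[rat]_n) : {set 'I_n} :=
  [set j | block k j != set0].

(* K is identified with the Rees product X * G * Y through
     k |-> (partition_of k, gc k, range_of k),
   X and Y being the sets of partitions and of ranges of the elements of K,
   with the multiplication
     (p, g, r) (p', g', r') = (p, g * phi r p' * g', r'). *)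
Record rees_product n (K : 'M[rat]_n -> Prop)
    (X : {set {set {set 'I_n}}}) (G : finGroupType) (Y : {set {set 'I_n}})
    (phi : {set 'I_n} -> {set {set 'I_n}} -> G) (gc : 'M[rat]_n -> G) : Prop :=
  ReesProduct {
    rees_X : forall p, p \in X <-> exists2 k, K k & partition_of k = p;
    rees_Y : forall r, r \in Y <-> exists2 k, K k & range_of k = r;
    rees_bij : forall p g r, p \in X -> r \in Y ->
      exists! k, [/\ K k, partition_of k = p, gc k = g & range_of k = r];
    rees_mul : forall k k', K k -> K k' ->
      [/\ partition_of (k *m k') = partition_of k,
          gc (k *m k') =
            (gc k * phi (range_of k) (partition_of k') * gc k')%g
        & range_of (k *m k') = range_of k']
  }.

Definition right_group n (K : 'M[rat]_n -> Prop) : Prop :=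
  exists (X : {set {set {set 'I_n}}}) (G : finGroupType)
         (Y : {set {set 'I_n}})
         (phi : {set 'I_n} -> {set {set 'I_n}} -> G) (gc : 'M[rat]_n -> G),
    rees_product K X Y phi gc /\ #|X| = 1%N.

(* Main.v *)
Require Import Defs.
From HB Require Import structures.
From mathcomp Require Import all_boot all_order all_algebra all_fingroup.
From Stdlib Require Import Classical.

Set Implicit Arguments.
Unset Strict Implicit.
Unset Printing Implicit Defensive.

Import Order.TTheory GRing.Theory Num.Theory.
Local Open Scope ring_scope.

(** A binary stochastic matrix is the matrix of a self-map of the vertices, and
    a product of matrices is the composition of the maps, the left factor
    acting first.  The argument rests on Friedman's theorem on the partitions
    in the kernel.  Since A is irreducible, it has a positive left fixed vector
    w, which weighs the vertices.  As A is the average of the C_i, the weight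
    of a set is the average of the weights of its preimages under the C_i.
    The preimage of a block of a kernel element is again such a block (or is
    empty), so a block of maximal weight has only preimages of maximal weight
    under the whole semigroup.  All blocks of every kernel element f arise as
    such preimages, by transitivity and because f and g o f have the same
    partition whenever both lie in the kernel.  Hence all blocks of all kernel
    elements have one and the same weight
    ([kernel_blocks_equal_weight]).

    A map of rank n - 1 has one block with two vertices and singletons
    otherwise.  If a kernel element f identifies two distinct vertices x and y
    and another one, g, separates them, then one of the two, say x, is a
    singleton block of g, whereas its block in f also contains y and therefore
    weighs strictly more.  So all kernel elements have the same partition.

    Finally a subsemigroup of constant rank with a single partition is a right
    group ([right_group_eq_partition]): every element permutes the common
    blocks, and it is determined by this permutation and its range.  With these
    coordinates the sandwich function of the Rees product is trivial. *)

(** * Maps as binary stochastic matrices *)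

Lemma classical_finset (T : finType) (P : T -> Prop) :
  exists A : {set T}, forall x, x \in A <-> P x.
Proof.
have: forall x, exists b : bool, b <-> P x.
  by move=> x; case: (classic (P x)) => Px; [exists true | exists false].
by case/fin_all_exists=> b bP; exists [set x | b x] => x; rewrite inE.
Qed.

Definition funmx n (f : 'I_n -> 'I_n) : 'M[rat]_n :=
  \matrix_(i, j) (f i == j)%:R.

Lemma funmxE n (f : 'I_n -> 'I_n) i j : funmx f i j = (f i == j)%:R.
Proof. by rewrite mxE. Qed.

Lemma funmx_eq1 n (f : 'I_n -> 'I_n) i j : (funmx f i j == 1) = (f i == j).
Proof. by rewrite funmxE; case: (f i == j). Qed.

Lemma eq_funmx n (f g : 'I_n -> 'I_n) : f =1 g -> funmx f = funmx g.
Proof. by move=> fg; apply/matrixP=> i j; rewrite !funmxE fg. Qed.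

Lemma funmx_inj n (f g : 'I_n -> 'I_n) : funmx f = funmx g -> f =1 g.
Proof.
by move=> fg i; apply/esym/eqP; rewrite -funmx_eq1 -fg funmx_eq1.
Qed.

Lemma mul_funmx n (f g : 'I_n -> 'I_n) :
  funmx f *m funmx g = funmx (g \o f).
Proof.
apply/matrixP=> i j; rewrite mxE (bigD1 (f i)) //= big1 ?addr0 => [|k neq].
  by rewrite !funmxE eqxx mul1r.
by rewrite funmxE eq_sym (negPf neq) mul0r.
Qed.

Lemma binary_stochastic_funmx n (M : 'M[rat]_n) :
  binary_stochastic M -> exists f, M = funmx f.
Proof.
case=> M01 /fin_all_exists[f fP]; exists f; apply/matrixP=> i j.
have [Mf uniq_f] := fP i; rewrite funmxE.
case: eqVneq => [<- // | neq]; case: (M01 i j) => // /uniq_f fj.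
by rewrite fj eqxx in neq.
Qed.

Lemma mem_block n (f : 'I_n -> 'I_n) i j :
  (i \in block (funmx f) j) = (f i == j).
Proof. by rewrite inE funmx_eq1. Qed.

Lemma range_funmx n (f : 'I_n -> 'I_n) :
  range_of (funmx f) = [set f x | x in 'I_n].
Proof.
apply/setP=> j; rewrite inE; apply/set0Pn/imsetP.
  by case=> i; rewrite mem_block => /eqP <-; exists i.
by case=> i _ ->; exists i; rewrite mem_block.
Qed.

(** The rows of the matrix are the unit vectors indexed by the values of the
    map. *)
Lemma rank_funmx n (f : 'I_n -> 'I_n) :
  \rank (funmx f) = #|range_of (funmx f)|.
Proof.
rewrite range_funmx; set A := [set f x | x in _].
have row_f i : row i (funmx f) = delta_mx 0 (f i).
  by apply/rowP=> j; rewrite !mxE eqxx /= eq_sym.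
have rows_f : (funmx f :=: \sum_(j in A) <<delta_mx 0 j : 'rV[rat]_n>>)%MS.
  apply/eqmxP/andP; split.
    apply/row_subP=> i; rewrite row_f.
    by rewrite (sumsmx_sup (f i)) ?imset_f // genmxE.
  apply/sumsmx_subP=> j /imsetP[i _ ->].
  by rewrite genmxE -row_f row_sub.
have inj_id : {in A &, injective (@id 'I_n)} by move=> ? ?.
rewrite rows_f (mxdirectP (mxdirect_delta _ inj_id)) /=.
by rewrite -sum1_card; apply: eq_bigr => j _; rewrite genmxE mxrank_delta.
Qed.

Lemma partition_funmx n (f : 'I_n -> 'I_n) :
  partition_of (funmx f) = [set [set y | f y == f x] | x in 'I_n].
Proof.
apply/setP=> B; apply/imsetP/imsetP.
  case=> j; rewrite !inE => /set0Pn[x]; rewrite mem_block => /eqP fx ->.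
  by exists x => //; apply/setP=> y; rewrite mem_block inE fx.
case=> x _ ->; exists (f x).
  by rewrite inE; apply/set0Pn; exists x; rewrite mem_block.
by apply/setP=> y; rewrite mem_block inE.
Qed.

(** Equality of partitions is equality of the kernels of the two maps; this is
    the form in which partitions are compared below. *)
Lemma eq_partition_funmx n (f g : 'I_n -> 'I_n) :
  partition_of (funmx f) = partition_of (funmx g) <->
  forall x y, (f x == f y) = (g x == g y).
Proof.
rewrite !partition_funmx; split=> [eq_fg x y | eq_fg]; last first.
  by apply: eq_imset => x; apply/setP=> y; rewrite !inE.
have /imsetP[z _ Bz] :
    [set t | f t == f y] \in [set [set t | g t == g u] | u in 'I_n].
  by rewrite -eq_fg imset_f.
have fgz t : (f t == f y) = (g t == g z).
  by move/setP: Bz => /(_ t); rewrite !inE.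
have /eqP gyz : g y == g z by rewrite -fgz.
by rewrite fgz gyz.
Qed.

(** * Semigroups of constant rank *)

(** The map g cannot collapse the range of f, for otherwise the rank would
    drop; so f and g o f have the same partition. *)
Lemma const_rank_comp n (K : 'M[rat]_n -> Prop) r (f g : 'I_n -> 'I_n) :
    kernel_rank K r -> K (funmx f) -> K (funmx (g \o f)) ->
  forall x y, (g (f x) == g (f y)) = (f x == f y).
Proof.
move=> rK /rK + /rK; rewrite !rank_funmx !range_funmx => <- rgf x y.
have /imset_injP g_inj : #|[set g u | u in [set f x | x in 'I_n]]|
    == #|[set f x | x in 'I_n]|.
  by rewrite -imset_comp rgf.
by apply/eqP/eqP=> [/g_inj | -> //]; apply; apply: imset_f.
Qed.

(** The range of g o f lies in that of g and has the same size. *)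
Lemma const_rank_range n (K : 'M[rat]_n -> Prop) r (f g : 'I_n -> 'I_n) :
    kernel_rank K r -> K (funmx g) -> K (funmx (g \o f)) ->
  range_of (funmx (g \o f)) = range_of (funmx g).
Proof.
move=> rK /rK + /rK; rewrite !rank_funmx => rg rgf.
apply/eqP; rewrite eqEcard rg rgf leqnn andbT !range_funmx.
by apply/subsetP=> _ /imsetP[x _ ->]; rewrite /= imset_f.
Qed.

(** * Right groups from a single partition *)

(** The permutation induced by k on the blocks of e, where the block of e
    containing x is labelled by the vertex e x.  Vertices outside the range of
    e label no block and are fixed, which makes the permutation unique. *)
Definition block_perm n (e : 'I_n -> 'I_n) (k : 'M[rat]_n) (s : {perm 'I_n}) :=
  perm_on [set e x | x in 'I_n] s
  && [forall x, forall y, (k x y == 1) ==> (s (e x) == e y)].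

Lemma block_permP n (e f : 'I_n -> 'I_n) (s : {perm 'I_n}) :
  reflect (perm_on [set e x | x in 'I_n] s /\ forall x, s (e x) = e (f x))
          (block_perm e (funmx f) s).
Proof.
apply: (iffP andP) => -[s_on sf]; split=> //.
  move=> x; apply/eqP; move/forallP/(_ x)/forallP/(_ (f x)): sf.
  by rewrite funmx_eq1 eqxx.
apply/forallP=> x; apply/forallP=> y; apply/implyP.
by rewrite funmx_eq1 sf => /eqP ->.
Qed.

Lemma block_perm_uniq n (e f : 'I_n -> 'I_n) (s t : {perm 'I_n}) :
  block_perm e (funmx f) s -> block_perm e (funmx f) t -> s = t.
Proof.
move=> /block_permP[s_on sf] /block_permP[t_on tf]; apply/permP=> j.
have [/imsetP[x _ ->] | j_out] := boolP (j \in [set e x | x in 'I_n]).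
  by rewrite sf tf.
by rewrite !(out_perm _ j_out).
Qed.

Lemma block_perm_mul n (e f g : 'I_n -> 'I_n) (s t : {perm 'I_n}) :
    block_perm e (funmx f) s -> block_perm e (funmx g) t ->
  block_perm e (funmx (g \o f)) (s * t).
Proof.
move=> /block_permP[s_on sf] /block_permP[t_on tf]; apply/block_permP.
by split=> [|x]; [apply: perm_onM | rewrite permM sf tf].
Qed.

Lemma block_perm_exists n (e f : 'I_n -> 'I_n) :
    (forall x y, (e (f x) == e (f y)) = (e x == e y)) ->
  exists s, block_perm e (funmx f) s.
Proof.
move=> ef.
pose h j := if [pick x | e x == j] is Some x then e (f x) else j.
have h_in x : h (e x) = e (f x).
  rewrite /h; case: pickP => [y | /(_ x)]; last by rewrite eqxx.
  by rewrite -ef => /eqP.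
have h_out j : j \notin [set e x | x in 'I_n] -> h j = j.
  rewrite /h; case: pickP => // x /eqP <-.
  by rewrite imset_f.
have h_inj : injective h.
  move=> i j.
  have [/imsetP[x _ ->] | i_out] := boolP (i \in [set e x | x in 'I_n]);
  have [/imsetP[y _ ->] | j_out] := boolP (j \in [set e x | x in 'I_n]).
  - by rewrite !h_in => /eqP; rewrite ef => /eqP.
  - by rewrite h_in (h_out j) // => xj; rewrite -xj imset_f in j_out.
  - by rewrite h_in (h_out i) // => xi; rewrite xi imset_f in i_out.
  - by rewrite !h_out.
exists (perm h_inj); apply/block_permP; split=> [|x]; last by rewrite permE.
apply/subsetP=> j; rewrite inE permE.
by apply: contraR => /h_out ->.
Qed.

(** The group is the set H of the permutations of the common blocks which are
    induced by elements of K.  Given a permutation s and a range, an element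
    with these coordinates is obtained from an f inducing s by composing with a
    power of any g having that range, the exponent being a multiple of the
    order of the permutation induced by g.  It is unique: two elements inducing
    the same permutation send x into the same block, and their common range
    meets each block at most once. *)
Lemma right_group_eq_partition n (K : 'M[rat]_n -> Prop) r :
    (exists k, K k) ->
    (forall k, K k -> exists f, k = funmx f) ->
    (forall x y, K x -> K y -> K (x *m y)) ->
    kernel_rank K r ->
    (forall k k', K k -> K k' -> partition_of k = partition_of k') ->
  right_group K.
Proof.
move=> [k0 Kk0] K_fun K_mul K_rank K_part.
have [e e_k0] := K_fun _ Kk0; have Ke : K (funmx e) by rewrite -e_k0.
have K_comp f g : K (funmx f) -> K (funmx g) -> K (funmx (g \o f)).
  by move=> Kf Kg; rewrite -mul_funmx; apply: K_mul.
have K_eq f g : K (funmx f) -> K (funmx g) ->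
    forall x y, (f x == f y) = (g x == g y).
  by move=> Kf Kg; apply/eq_partition_funmx/K_part.
have K_inj f g : K (funmx f) -> K (funmx g) ->
    forall x y, (g (f x) == g (f y)) = (f x == f y).
  by move=> Kf Kg; apply: const_rank_comp K_rank Kf (K_comp _ _ Kf Kg).
have K_range f g : K (funmx f) -> K (funmx g) ->
    range_of (funmx (g \o f)) = range_of (funmx g).
  by move=> Kf Kg; apply: const_rank_range K_rank Kg (K_comp _ _ Kf Kg).
have K_perm f : K (funmx f) -> exists s, block_perm e (funmx f) s.
  move=> Kf; apply: block_perm_exists => x y.
  by rewrite (K_inj f e) // (K_eq f e).
have [H HP] := classical_finset (fun s : {perm 'I_n} =>
  exists2 f, K (funmx f) & block_perm e (funmx f) s).
have K_pow f g s t m :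
    K (funmx f) -> block_perm e (funmx f) s ->
    K (funmx g) -> block_perm e (funmx g) t ->
  exists h, [/\ K (funmx h), block_perm e (funmx h) (s * t ^+ m.+1)%g
              & range_of (funmx h) = range_of (funmx g)].
  move=> Kf fs Kg gt; elim: m => [|m [h [Kh hs h_range]]].
    exists (g \o f); split; [exact: K_comp | | exact: K_range].
    exact: block_perm_mul.
  exists (g \o h); split; [exact: K_comp | | exact: K_range].
  by rewrite expgSr mulgA; apply: block_perm_mul.
have H_group : group_set H.
  apply/group_setP; split=> [|s t /HP[f Kf fs] /HP[g Kg gt]].
    (* The identity is s to the power 2 #[s]; the doubling keeps the exponent
       at least 2, as the pattern s * s ^+ m.+1 requires. *)
    have [s es] := K_perm _ Ke.
    have [h [Kh hs _]] := K_pow _ _ _ _ #[s]%g.*2.-2 Ke es Ke es.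
    apply/HP; exists h => //.
    suff -> : 1%g = (s * s ^+ #[s]%g.*2.-2.+1)%g by [].
    have -> : (s * s ^+ #[s]%g.*2.-2.+1)%g = (s ^+ #[s]%g.*2)%g.
      by rewrite -expgS; case: #[s]%g (order_gt0 s).
    by rewrite -muln2 expgM expg_order expg1n.
  by apply/HP; exists (g \o f); [apply: K_comp | apply: block_perm_mul].
pose G := Group H_group.
pose gc (k : 'M[rat]_n) := subg G (odflt 1%g [pick s | block_perm e k s]).
have gcE f s : block_perm e (funmx f) s -> gc (funmx f) = subg G s.
  move=> fs; rewrite /gc; case: pickP => [t ft | /(_ s)]; last by rewrite fs.
  by rewrite (block_perm_uniq ft fs).
have [Y YP] := classical_finset (fun B => exists2 k, K k & range_of k = B).
exists [set partition_of k0], [subg G], Y, (fun _ _ => 1%g), gc.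
split; last exact: cards1.
split=> // [p | p g B | k k' Kk Kk'].
- rewrite inE; split=> [/eqP -> | [k Kk <-]]; first by exists k0.
  by rewrite (K_part k k0).
- rewrite inE => /eqP -> {p} /YP[k Kk <-{B}].
  have [f2 f2E] := K_fun _ Kk; rewrite {k}f2E in Kk *.
  have [f1 Kf1 f1s] : exists2 f, K (funmx f) & block_perm e (funmx f) (sgval g).
    by apply/HP/(subgP g).
  have [t f2t] := K_perm _ Kk.
  have [h [Kh]] := K_pow _ _ _ _ #[t]%g.-1 Kf1 f1s Kk f2t.
  rewrite prednK // expg_order mulg1 => hs h_range.
  exists (funmx h); split=> [|k' [Kk' _ gc_k' range_k']].
    by split=> //; [apply: K_part | rewrite (gcE _ _ hs) sgvalK].
  have [f' f'E] := K_fun _ Kk'; rewrite {k'}f'E in Kk' gc_k' range_k' *.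
  have [s' f's'] := K_perm _ Kk'.
  have s'H : s' \in G by apply/HP; exists f'.
  have s'E : s' = sgval g by rewrite -gc_k' (gcE _ _ f's') subgK.
  rewrite s'E in f's'; apply: eq_funmx => x.
  have /block_permP[_ /(_ x) hx] := hs; have /block_permP[_ /(_ x) f'x] := f's'.
  (* h and f' agree at x up to a block, and both values lie in one range. *)
  have : h x \in range_of (funmx f').
    by rewrite range_k' -h_range range_funmx imset_f.
  rewrite range_funmx => /imsetP[z _ hxz]; rewrite hxz.
  have : e (h x) == e (f' x) by rewrite -hx -f'x.
  by rewrite hxz (K_inj f' e) // => /eqP.
- have [f fE] := K_fun _ Kk; have [f' f'E] := K_fun _ Kk'.
  rewrite {k}fE in Kk *; rewrite {k'}f'E in Kk' *; rewrite mul_funmx.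
  have [s fs] := K_perm _ Kk; have [t ft] := K_perm _ Kk'.
  split; [by apply: K_part => //; apply: K_comp | | exact: K_range].
  rewrite mulg1 (gcE _ _ fs) (gcE _ _ ft) (gcE _ _ (block_perm_mul fs ft)).
  by rewrite subgM //; apply/HP; [exists f | exists f'].
Qed.

(** * Stationary weights and transitivity *)

(** Perron's argument.  As 1 is an eigenvalue of A with constant right
    eigenvector, there is a nonzero left fixed vector v.  The vector w of the
    absolute values satisfies w <= w A entrywise, and both sides have the same
    total, so w is fixed too.  Irreducibility spreads a positive entry to all
    vertices. *)
Lemma stationary_vector n (A : 'M[rat]_n) :
    (0 < n)%N -> (forall i j, 0 <= A i j) -> (forall i, \sum_j A i j = 1) ->
    irreducible_mx A ->
  exists w : 'rV[rat]_n, w *m A = w /\ forall i, 0 < w 0 i.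
Proof.
move=> n_gt0 A_ge0 A_row A_irr.
have one_fix : A *m const_mx 1 = const_mx 1 :> 'cV_n.
  apply/colP=> i; rewrite !mxE -[RHS](A_row i).
  by apply: eq_bigr => j _; rewrite mxE mulr1.
have singular : ~~ row_free (A - 1%:M).
  rewrite row_free_unit; apply/negP=> /mulKmx/(_ (const_mx 1 : 'cV_n)).
  rewrite mulmxBl one_fix mul1mx subrr mulmx0 => /colP/(_ (Ordinal n_gt0)).
  by rewrite !mxE.
have [v v_neq0 v_fix] : exists2 v : 'rV[rat]_n, v != 0 & v *m A = v.
  move: singular; rewrite -kermx_eq0 -nz_row_eq0 => v_neq0.
  exists (nz_row (kermx (A - 1%:M))) => //; apply/eqP.
  by rewrite -subr_eq0 -{2}[nz_row _]mulmx1 -mulmxBr -sub_kermx nz_row_sub.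
pose w : 'rV[rat]_n := map_mx (fun x => `|x|) v.
have w_ge0 i : 0 <= w 0 i by rewrite mxE.
have w_le j : 0 <= (w *m A) 0 j - w 0 j.
  rewrite subr_ge0 [w 0 j]mxE -{1}v_fix !mxE.
  apply: le_trans (ler_norm_sum _ _ _) _; apply: ler_sum => i _.
  by rewrite normrM mxE (ger0_norm (A_ge0 i j)).
have w_fix : w *m A = w.
  apply/rowP=> j; apply/eqP; rewrite -subr_eq0; apply/eqP.
  apply: (psumr_eq0P (P := xpredT) (fun i _ => w_le i)) => //.
  rewrite sumrB; apply/eqP; rewrite subr_eq0; apply/eqP.
  under eq_bigr do rewrite mxE.
  rewrite exchange_big /=; apply: eq_bigr => i _.
  by rewrite -mulr_sumr A_row mulr1.
have pow_fix m : w *m (A ^+ m) = w.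
  elim: m => [|m IH]; first by rewrite expr0 mulmx1.
  by rewrite exprS mulmxA w_fix IH.
have pow_ge0 m i j : 0 <= (A ^+ m) i j.
  elim: m i j => [|m IH] i j; first by rewrite expr0 mxE ler0n.
  by rewrite exprS mxE sumr_ge0 // => k _; rewrite mulr_ge0.
have [i vi_neq0] : exists i, v 0 i != 0 by apply/rV0Pn.
exists w; split=> // j; have [m _ Aij] := A_irr i j.
rewrite -(pow_fix m) mxE (bigD1 i) //= ltr_wpDr //.
  by apply: sumr_ge0 => k _; rewrite mulr_ge0.
by rewrite mulr_gt0 // mxE normr_gt0.
Qed.

Lemma semigroup_funmx n d (C : 'I_d -> 'M[rat]_n) :
    (forall i, binary_stochastic (C i)) ->
  forall s, semigroup_gen C s -> exists f, s = funmx f.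
Proof.
move=> C_bs s; elim=> [i | _ _ _ [f ->] _ [g ->]].
  exact: binary_stochastic_funmx.
by exists (g \o f); rewrite mul_funmx.
Qed.

(** A nonzero entry of a power of A exhibits a path in the graph, that is a word
    in the generators moving x to y. *)
Lemma semigroup_transitive n d (C : 'I_d -> 'M[rat]_n)
    (c : 'I_d -> 'I_n -> 'I_n) (a : rat) :
    (forall i, C i = funmx (c i)) -> irreducible_mx (a *: \sum_i C i) ->
  forall x y, exists2 g, semigroup_gen C (funmx g) & g x = y.
Proof.
move=> Cc irr x y; have [[//|m] _] := irr x y.
set A := a *: _; move/lt0r_neq0.
have step i j : A i j != 0 -> exists l, c l i = j.
  move=> Aij; apply: NNPP => no_l; case/eqP: Aij.
  rewrite mxE summxE big1 ?mulr0 // => l _.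
  rewrite Cc funmxE; case: eqVneq => // cl.
  by case: no_l; exists l.
elim: m x => [|m IH] x.
  rewrite expr1 => /step[l <-]; exists (c l) => //.
  by rewrite -Cc; apply: SemigroupGen.
rewrite exprS mxE => sum_neq0.
have [z] : exists z, A x z * (A ^+ m.+1) z y != 0.
  apply/existsP; apply: contraNT sum_neq0; rewrite negb_exists => /forallP all0.
  by apply/eqP/big1 => z _; apply/eqP; rewrite -[_ == _]negbK.
rewrite mulf_eq0 negb_or => /andP[/step[l <-] /IH[g Sg <-]].
exists (g \o c l) => //.
by rewrite -mul_funmx -Cc; apply: SemigroupMul => //; apply: SemigroupGen.
Qed.

(** Invariance of w in terms of sets: for a = 1 / d, the weight of B is the
    average of the weights of its preimages under the generators. *)
Lemma sum_preimage_stationary n d (C : 'I_d -> 'M[rat]_n)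
    (c : 'I_d -> 'I_n -> 'I_n) (a : rat) (w : 'rV[rat]_n) (B : {set 'I_n}) :
    (forall i, C i = funmx (c i)) -> w *m (a *: \sum_i C i) = w ->
  \sum_(x in B) w 0 x = a * \sum_l \sum_(x in c l @^-1: B) w 0 x.
Proof.
move=> Cc w_fix; rewrite -{1}w_fix -scalemxAr mulmx_sumr.
under eq_bigr do rewrite mxE summxE; rewrite -mulr_sumr exchange_big /=.
congr (_ * _); apply: eq_bigr => l _.
under eq_bigr do rewrite mxE; rewrite exchange_big /= [RHS]big_mkcond /=.
apply: eq_bigr => x _; under eq_bigr do rewrite Cc funmxE.
rewrite -mulr_sumr inE; have [cxB | cxB] := ifPn.
  rewrite (bigD1 (c l x)) //= eqxx big1 ?addr0 ?mulr1 // => y /andP[_].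
  by rewrite eq_sym => /negPf ->.
rewrite big1 ?mulr0 // => y yB; case: eqVneq => // cy.
by rewrite cy yB in cxB.
Qed.

(** * Friedman's theorem *)

(** A maximum that is an average of values not exceeding it is equal to each of
    them; this propagates the maximal weight from one block of the kernel to
    all its preimages. *)
Lemma kernel_blocks_equal_weight n d (C : 'I_d -> 'M[rat]_n)
    (K : 'M[rat]_n -> Prop) r :
    (0 < n)%N -> (forall i, binary_stochastic (C i)) ->
    irreducible_mx (d%:R^-1 *: \sum_i C i) ->
    ideal (semigroup_gen C) K -> kernel_rank K r ->
  exists (w : 'I_n -> rat) (M : rat), (forall i, 0 < w i) /\
    forall f x, K (funmx f) -> \sum_(y | f y == f x) w y = M.
Proof.
move=> n_gt0 C_bs irr [[k0 Kk0] K_S K_left K_right] K_rank.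
have [c Cc] := fin_all_exists (fun i => binary_stochastic_funmx (C_bs i)).
have S_fun := semigroup_funmx C_bs.
have d_gt0 : (0 < d)%N.
  by elim: (K_S _ Kk0) => // i; apply: leq_ltn_trans (ltn_ord i).
have a_gt0 : 0 < d%:R^-1 :> rat by rewrite invr_gt0 ltr0n.
have ad1 : d%:R^-1 * d%:R = 1 :> rat by rewrite mulVf // pnatr_eq0 -lt0n.
have [w0 [w_fix w_gt0]] : exists w : 'rV[rat]_n,
    w *m (d%:R^-1 *: \sum_i C i) = w /\ forall i, 0 < w 0 i.
  apply: stationary_vector => // [i j | i].
    rewrite mxE summxE; apply: mulr_ge0; first exact: ltW.
    apply: sumr_ge0 => l _.
    by rewrite Cc funmxE ler0n.
  under eq_bigr do rewrite mxE summxE; rewrite -mulr_sumr exchange_big /=.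
  rewrite (eq_bigr (fun=> 1)) ?sumr_const ?card_ord // => l _.
  rewrite (bigD1 (c l i)) //= big1 => [|j].
    by rewrite Cc funmxE eqxx addr0.
  by rewrite Cc funmxE eq_sym => /negPf ->.
pose w i := w0 0 i; exists w.
have w_inv B := sum_preimage_stationary B Cc w_fix.
pose weight (B : {set 'I_n}) := \sum_(x in B) w x.
(* The fibres of kernel elements.  The empty fibre is kept, so that this family
   is stable under preimages; the heaviest fibre is nonempty, w being
   positive. *)
have [Bs BsP] := classical_finset (fun B : {set 'I_n} =>
  exists2 f, K (funmx f) & exists j, B = f @^-1: [set j]).
have Bs_preim g B : semigroup_gen C (funmx g) -> B \in Bs -> g @^-1: B \in Bs.
  move=> Sg /BsP[f Kf [j ->]]; apply/BsP; exists (f \o g).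
    by rewrite -mul_funmx; apply: K_left.
  by exists j; apply/setP=> x; rewrite !inE.
have [f0 f0E] := S_fun _ (K_S _ Kk0); rewrite {k0}f0E in Kk0.
pose x0 := Ordinal n_gt0.
have B0 : f0 @^-1: [set f0 x0] \in Bs.
  by apply/BsP; exists f0 => //; exists (f0 x0).
pose Bmax := [arg max_(B > f0 @^-1: [set f0 x0] in Bs) weight B]%O.
have [Bmax_in Bmax_max] :
    Bmax \in Bs /\ forall B, B \in Bs -> weight B <= weight Bmax.
  by rewrite /Bmax; case: arg_maxP.
(* The deficits of the preimages under the generators are nonnegative and sum
   to zero. *)
have gen_max l B : B \in Bs -> weight B = weight Bmax ->
    weight (c l @^-1: B) = weight Bmax.
  move=> B_in B_max; apply/esym/eqP; rewrite -subr_eq0; apply/eqP.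
  have diff_ge0 i : 0 <= weight Bmax - weight (c i @^-1: B).
    by rewrite subr_ge0 Bmax_max // Bs_preim // -Cc; apply: SemigroupGen.
  apply: (psumr_eq0P (P := xpredT) (fun i _ => diff_ge0 i)) => //.
  apply: (mulfI (lt0r_neq0 a_gt0)).
  rewrite mulr0 sumrB mulrBr -w_inv -/(weight B) sumr_const card_ord.
  by rewrite -[X in _ * X]mulr_natl mulrA ad1 mul1r B_max subrr.
have S_max s : semigroup_gen C s -> forall g, s = funmx g ->
    forall B, B \in Bs -> weight B = weight Bmax ->
    weight (g @^-1: B) = weight Bmax.
  elim=> [l | x y Sx IHx Sy IHy] g gE B B_in B_max.
    rewrite -(gen_max l B) //; congr weight; apply/setP=> z; rewrite !inE.
    by rewrite (@funmx_inj _ (c l) g) // -Cc.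
  have [gx gxE] := S_fun _ Sx; have [gy gyE] := S_fun _ Sy.
  have -> : g @^-1: B = gx @^-1: (gy @^-1: B).
    apply/setP=> z; rewrite !inE (@funmx_inj _ g (gy \o gx)) //.
    by rewrite -gE gxE gyE mul_funmx.
  apply: IHx => //; first by apply: Bs_preim => //; rewrite -gyE.
  exact: IHy.
exists (weight Bmax); split=> // f x Kf.
have [j j_in] : exists j, j \in Bmax.
  apply/set0Pn; apply/eqP=> Bmax0.
  have := Bmax_max _ B0.
  rewrite Bmax0 {2}/weight big_set0 leNgt => /negP; apply.
  rewrite /weight (bigD1 x0) ?inE //= ltr_wpDr //.
  by apply: sumr_ge0 => y _; apply: ltW.
have /BsP[fm Kfm [jm BmaxE]] := Bmax_in.
(* With g moving f x into the heaviest fibre, the preimage of that fibre under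
   g o f is a block of fm o g o f, which has the same partition as f. *)
have [g Sg gj] := semigroup_transitive Cc irr (f x) j.
have Sgf : semigroup_gen C (funmx (g \o f)).
  by rewrite -mul_funmx; apply: SemigroupMul => //; apply: K_S.
rewrite -(S_max _ Sgf _ erefl Bmax Bmax_in erefl).
apply: eq_bigl => y; rewrite BmaxE !inE /=.
have -> : jm = fm (g (f x)).
  by move: j_in; rewrite -gj BmaxE !inE => /eqP.
apply/esym; apply: (@const_rank_comp _ K r f (fm \o g)) => //.
rewrite -mul_funmx; apply: K_right => //.
by rewrite -mul_funmx; apply/K_S/K_left.
Qed.

(** * Rank one less than the number of vertices *)

(** If neither block were a singleton, both x and y could be deleted without
    changing the range, which would then have at most n - 2 elements. *)
Lemma corank1_block_singleton n (g : 'I_n -> 'I_n) x y :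
    \rank (funmx g) = (n - 1)%N -> g x != g y ->
  (forall z, g z = g x -> z = x) \/ (forall z, g z = g y -> z = y).
Proof.
rewrite rank_funmx range_funmx => rank_g gxy.
have block_case u : (forall z, g z = g u -> z = u) \/
    exists2 z, g z = g u & z != u.
  pose twin := [pred z | (g z == g u) && (z != u)].
  have [z /andP[/eqP gz zu] | no_z] := pickP twin.
    by right; exists z.
  by left=> z gz; apply/eqP; have := no_z z; rewrite /= gz eqxx => /negbFE.
have [|[a ga ax]] := block_case x; first by left.
have [|[b gb yb]] := block_case y; first by right.
have xy : x != y by apply: contraNneq gxy => ->.
have: [set g z | z in 'I_n] \subset [set g z | z in ~: [set x; y]].
  apply/subsetP=> _ /imsetP[z _ ->].
  have [-> | zx] := eqVneq z x.
    rewrite -ga imset_f // !inE negb_or ax /=.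
    by apply: contraNneq gxy => <-; rewrite ga.
  have [-> | zy] := eqVneq z y.
    rewrite -gb imset_f // !inE negb_or yb andbT.
    by apply: contraNneq gxy => <-; rewrite gb.
  by rewrite imset_f // !inE negb_or zx.
move/subset_leq_card; rewrite rank_g => /leq_trans/(_ (leq_imset_card _ _)).
have := cardsC [set x; y]; rewrite cards2 xy card_ord => {1}<-.
by rewrite addSn subn1 /= add1n ltnn.
Qed.

Theorem mainTheorem17 (n d : nat) (Adj : 'M[nat]_n) (C : 'I_d -> 'M[rat]_n)
    (K : 'M[rat]_n -> Prop)
    (n_ge2 : (2 <= n)%N)
    (Adj_out : out_regular d Adj)
    (A_irr : irreducible_mx (d%:R^-1 *: adjacency_mx Adj))
    (A_aper : aperiodic_mx (d%:R^-1 *: adjacency_mx Adj))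
    (C_bs : forall i : 'I_d, binary_stochastic (C i))
    (Adj_sum : adjacency_mx Adj = \sum_(i < d) C i)
    (K_ker : is_kernel (semigroup_gen C) K)
    (K_rank : kernel_rank K (n - 1)) :
  right_group K.
Proof.
have [K_ideal _] := K_ker; have [[k0 Kk0] K_S K_left K_right] := K_ideal.
have S_fun := semigroup_funmx C_bs.
rewrite Adj_sum in A_irr.
have [w [M [w_gt0 wM]]] :=
  kernel_blocks_equal_weight (ltnW n_ge2) C_bs A_irr K_ideal K_rank.
(* If g separates x and y, then one of them is a singleton block of g, and is
   strictly lighter than its block in f. *)
have same_pairs f g x y : K (funmx f) -> K (funmx g) -> f x = f y -> g x = g y.
  have singleton u v : K (funmx f) -> K (funmx g) -> f u = f v ->
      (forall z, g z = g u -> z = u) -> u = v.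
    move=> Kf Kg fuv gu; apply/eqP; have [// | neq_uv] := eqVneq u v.
    have := wM g u Kg; rewrite (big_pred1 u) => [wu | z]; last first.
      by apply/eqP/eqP=> [/gu | ->].
    have: w u < M; last by rewrite wu ltxx.
    rewrite -(wM f u Kf) (bigD1 u) //= ltrDl (bigD1 v) /=; last first.
      by rewrite fuv eqxx eq_sym.
    by rewrite ltr_wpDr // sumr_ge0 // => z _; apply: ltW.
  move=> Kf Kg fxy; apply/eqP; apply: contraTT isT => gxy.
  have xy : x <> y by move=> xy; rewrite xy eqxx in gxy.
  case: (corank1_block_singleton (K_rank _ Kg) gxy) => [gx | gy].
    by case: xy; apply: singleton.
  by case: xy; apply/esym/singleton.
apply: (@right_group_eq_partition _ _ (n - 1)) => //.
- by exists k0.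
- by move=> k /K_S/S_fun.
- by move=> x y /K_S; apply: K_left.
move=> k k' Kk Kk'.
have [f fE] := S_fun _ (K_S _ Kk); have [f' f'E] := S_fun _ (K_S _ Kk').
rewrite {k}fE in Kk *; rewrite {k'}f'E in Kk' *.
apply/eq_partition_funmx => x y.
by apply/eqP/eqP; apply: same_pairs.
Qed.
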